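(* Let $p$ be a prime, $n\ge1$ an integer, $A=\mathbb F_p^{2n}$, $N=p^n$. Let $U\in\mathrm U(N)$ and let $k\ge1$ be an integer. The following are equivalent: (i) $\lVert U\rVert_{Q^k}=1$; (ii) the Weyl orbit map $F_U:A\to\mathrm U(N)$, $F_U(a)=W_aUW_a^*$, has Leibman degree at most $k-1$ (i.e. is polynomial of degree at most $k-1$ in the sense of Leibman). Consequently, for $k\ge2$, these conditions are equivalent to $U\in\mathcal C^{(k-1)}$, where $\mathcal C^{(k-1)}$ is the $(k-1)$th level of the Clifford hierarchy.
   Context: Weyl operators. Let $p$ be a prime, $n\ge1$, $A=\mathbb F_p^{2n}$ (viewed as an additive group), $N=p^n$. Write elements of $A$ as $a=(u,v)$ with $u,v\in\mathbb F_p^n$. Let $\omega=e^{2\pi i/p}$, $\tau_p=(-1)^pe^{\pi i/p}$, and let $D_p=2p$ if $p=2$ and $D_p=p$ otherwise (so $\tau_p$ has order $D_p$). On $\mathbb C^{\mathbb F_p^n}\cong\mathbb C^N$ with standard basis $|x\rangle$, $x\in\mathbb F_p^n$, let $X^v|x\rangle=|x+v\rangle$ and $Z^u|x\rangle=\omega^{x\cdot u}|x\rangle$. The Weyl operator of $a=(u,v)$ is $W_a=\tau_p^{-\sum_{j=1}^n|u_jv_j|}Z^uX^v$, where $|\cdot|:\mathbb F_p\to\{0,\dots,p-1\}\subset\mathbb Z$ is the standard section. Clifford hierarchy. $\mathrm U(N)\subset \mathrm M_N(\mathbb C)$ is the unitary group. $\mathcal C^{(1)}$ is the Pauli group $\{\tau_p^tW_a:t\in\mathbb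 Z/D_p\mathbb Z,\ a\in A\}$, and for $k\ge2$, $\mathcal C^{(k)}=\{U\in\mathrm U(N):U\mathcal C^{(1)}U^*\subseteq\mathcal C^{(k-1)}\}$. Quantum uniformity norms. On $\mathrm M_N(\mathbb C)$ (the $N\times N$ complex matrices, i.e. operators on $\mathbb C^{\mathbb F_p^n}$) let $\langle S,T\rangle=\frac1N\operatorname{tr}(S^*T)$; $\mathbf 1$ is the identity matrix and $\mathbb E$ denotes the uniform average over a finite set. For $h\in A$, $T\in \mathrm M_N(\mathbb C)$, put $\partial_hT=W_hTW_h^*T^*$ and $\partial_{h_k,\dots,h_1}=\partial_{h_k}\circ\cdots\circ\partial_{h_1}$. For $k\ge1$, $\lVert T\rVert_{Q^k}\ge 0$ is defined by $$\lVert T\rVert_{Q^k}^{2^k}=\mathbb E_{h_1,\dots,h_k\in A}\langle \mathbf 1,\partial_{h_k,\dots,h_1}T\rangle ,$$ the average being a nonnegative real number. Leibman polynomial maps. For groups $G,H$, a map $\phi:G\to H$ is polynomial of degree at most $-1$ if it is identically $1_H$. For an integer $k\ge0$, $\phi$ is polynomial of degree at most $k$ if for every $h\in G$ the map $(\Delta_h\phi)(g)=\phi(hg)\phi(g)^{-1}$ is polynomial of degree at most $k-1$. (For $G=A$, $hg$ is $h+g$.)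
   Formalization: For k=2 the equivalence with U in C^(1) is false as stated (U=c·1 with |c|=1, c not a power of tau_p); it is proved as: cU in C^(1) for some c with |c|=1. For k≥3 the equivalence with U in C^(k-1) is proved literally. *)

(* Defs.v *)
From HB Require Import structures.
From mathcomp Require Import all_boot all_order all_algebra all_fingroup.
From mathcomp Require Import complex.
From mathcomp Require Import reals trigo.

Set Implicit Arguments.
Unset Strict Implicit.
Unset Printing Implicit Defensive.

Import Order.TTheory GRing.Theory Num.Theory.
Local Open Scope ring_scope.
Local Open Scope complex_scope.
Local Open Scope sesquilinear_scope.

Record unitary_group (C : numClosedFieldType) (m : nat) := UnitaryGroup {
  unitary_val :> 'M[C]_m;
  unitary_valP : unitary_val \is unitarymx }.

Section UnitaryGroup.
Variables (C : numClosedFieldType) (m : nat).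
Local Notation UG := (unitary_group C m).

HB.instance Definition _ := [isSub for @unitary_val C m].
HB.instance Definition _ := [Choice of UG by <:].

Fact unitary_one_subproof : (1%:M : 'M[C]_m) \is unitarymx.
Proof. by apply/unitarymxP; rewrite trmx1 map_mx1 mulmx1. Qed.

Fact unitary_mul_subproof (U V : UG) : (U : 'M_m) *m V \is unitarymx.
Proof. exact: mul_unitarymx (unitary_valP U) (unitary_valP V). Qed.

Fact unitary_inv_subproof (U : UG) : (U : 'M_m)^t* \is unitarymx.
Proof. by rewrite trmxC_unitary unitary_valP. Qed.

Definition unitary_one : UG := UnitaryGroup unitary_one_subproof.
Definition unitary_mul (U V : UG) : UG :=
  UnitaryGroup (unitary_mul_subproof U V).
Definition unitary_inv (U : UG) : UG := UnitaryGroup (unitary_inv_subproof U).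

Fact unitary_mulA : associative unitary_mul.
Proof. by move=> U V W; apply: val_inj; rewrite /= mulmxA. Qed.
Fact unitary_mul1 : left_id unitary_one unitary_mul.
Proof. by move=> U; apply: val_inj; rewrite /= mul1mx. Qed.
Fact unitary_1mul : right_id unitary_one unitary_mul.
Proof. by move=> U; apply: val_inj; rewrite /= mulmx1. Qed.
Fact unitary_mulV : right_inverse unitary_one unitary_inv unitary_mul.
Proof. by move=> U; apply: val_inj; rewrite /= (unitarymxP (unitary_valP U)). Qed.
Fact unitary_Vmul : left_inverse unitary_one unitary_inv unitary_mul.
Proof.
by move=> U; apply: val_inj; rewrite /= (mulmx1C (unitarymxP (unitary_valP U))).
Qed.

HB.instance Definition _ := isGroup.Build UG
  unitary_mulA unitary_mul1 unitary_1mul unitary_Vmul unitary_mulV.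
End UnitaryGroup.

Definition leibman_diff (G H : groupType) (h : G) (phi : G -> H) : G -> H :=
  fun g => (phi (h * g) * (phi g)^-1)%g.

(* [leibman_deg_lt k phi]: phi is polynomial of degree at most k - 1. *)
Fixpoint leibman_deg_lt (G H : groupType) (k : nat) (phi : G -> H) : Prop :=
  match k with
  | 0 => forall g : G, phi g = 1%g
  | k'.+1 => forall h : G, leibman_deg_lt k' (leibman_diff h phi)
  end.

Section Weyl.
Variable R : realType.

(* e^{it} *)
Definition cis (t : R) : R[i] := cos t +i* sin t.

Variables p n : nat.

Definition omega : R[i] := cis (2 * pi / p%:R).
Definition tau : R[i] := (-1) ^+ p * cis (pi / p%:R).
Definition tau_order : nat := if p == 2%N then (2 * p)%N else p.

(* Matrices are indexed by the vectors x of F_p^n through the enumeration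
   [enum_val]; the dimension is p ^ n when p is prime (lemma [card_basis]).
   Operators act on column vectors: column x holds the image of |x>. *)
Definition basis : finType := 'rV['F_p]_n.
Definition hdim : nat := #|basis|.

Lemma card_basis : prime p -> hdim = (p ^ n)%N.
Proof. by move=> pP; rewrite /hdim /basis card_mx card_Fp // mul1n. Qed.

Definition phase_space : Type := ('rV['F_p]_n * 'rV['F_p]_n)%type.

Definition weylX (v : 'rV['F_p]_n) : 'M[R[i]]_hdim :=
  \matrix_(y, x) (enum_val y == enum_val x + v :> 'rV['F_p]_n)%:R.

Definition dotp (x u : 'rV['F_p]_n) : 'F_p := \sum_(j < n) x 0 j * u 0 j.

(* Exponents in 'F_p coerce to their representative in {0, ..., p - 1}. *)
Definition weylZ (u : 'rV['F_p]_n) : 'M[R[i]]_hdim :=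
  diag_mx (\row_x omega ^+ dotp (enum_val x) u).

Definition weyl (a : phase_space) : 'M[R[i]]_hdim :=
  tau ^- (\sum_(j < n) nat_of_ord (a.1 0 j * a.2 0 j : 'F_p)%R)
    *: (weylZ a.1 *m weylX a.2).

Fact norm_cis t : `|cis t| = 1.
Proof. by rewrite normc_def /= cos2Dsin2 sqrtr1. Qed.

Fact norm_omega : `|omega| = 1. Proof. exact: norm_cis. Qed.
Fact norm_tau : `|tau| = 1.
Proof. by rewrite normrM normrX normrN1 expr1n mul1r norm_cis. Qed.

Fact weylX_unitary v : weylX v \is unitarymx.
Proof.
apply/unitarymxP/matrixP => i j; rewrite !mxE.
rewrite (bigD1 (enum_rank (enum_val i - v : basis))) //= big1 => [|k kP].
  rewrite !mxE enum_rankK subrK eqxx mul1r addr0 rmorph_nat eq_sym.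
  by rewrite (inj_eq enum_val_inj).
rewrite !mxE; case: eqP => [E|_]; last by rewrite mul0r.
case/eqP: kP; apply: enum_val_inj; rewrite enum_rankK E.
by rewrite addrK.
Qed.

Fact weylZ_unitary u : weylZ u \is unitarymx.
Proof.
apply/unitarymxP/matrixP => i j; rewrite /weylZ mul_diag_mx !mxE.
case: eqVneq => [->|ij]; last by rewrite rmorph0 mulr0.
by rewrite mulr1n -normCK normrX norm_omega !expr1n.
Qed.

Fact weyl_unitary a : weyl a \is unitarymx.
Proof.
have /unitarymxP ZXE := mul_unitarymx (weylZ_unitary a.1) (weylX_unitary a.2).
apply/unitarymxP; rewrite /weyl linearZ /= map_mxZ -scalemxAl -scalemxAr ZXE.
by rewrite scalerA -normCK normrV ?unitfE ?normrX ?norm_tau ?expr1n ?invr1 ?expr1n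
   ?scale1r ?expf_neq0 // -normr_gt0 norm_tau.
Qed.

Definition weylU (a : phase_space) : unitary_group R[i] hdim :=
  UnitaryGroup (weyl_unitary a).

(* the inverse in [unitary_group] is the conjugate transpose *)
Definition weyl_orbit (U : unitary_group R[i] hdim) :
    phase_space -> unitary_group R[i] hdim :=
  fun a => (weylU a * U * (weylU a)^-1)%g.

Definition pauli (P : 'M[R[i]]_hdim) : Prop :=
  exists (t : 'I_tau_order) (a : phase_space), P = tau ^+ t *: weyl a.

(* Levels start at 1; level 0 is a dummy empty value. *)
Fixpoint clifford (k : nat) (U : 'M[R[i]]_hdim) : Prop :=
  match k with
  | 0 => False
  | 1 => pauli U
  | k'.+1 => U \is unitarymx /\
             forall P, pauli P -> clifford k' (U *m P *m U^t* )
  end.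

Definition avg (T : finType) (F : T -> R[i]) : R[i] :=
  (#|T|%:R)^-1 * \sum_(x : T) F x.

Definition inner (S T : 'M[R[i]]_hdim) : R[i] := (hdim%:R)^-1 * \tr (S^t* *m T).

Definition weyl_diff (h : phase_space) (T : 'M[R[i]]_hdim) : 'M[R[i]]_hdim :=
  weyl h *m T *m (weyl h)^t* *m T^t*.

(* [:: h_1; ...; h_k] gives the composite of the [weyl_diff h_i], h_1 first. *)
Definition weyl_diffs (hs : seq phase_space) (T : 'M[R[i]]_hdim) :
    'M[R[i]]_hdim :=
  foldl (fun S h => weyl_diff h S) T hs.

(* [d.-root z] is the nonnegative real d-th root when z is a nonnegative real,
   as the average is here for k >= 1. *)
Definition Qnorm (k : nat) (T : 'M[R[i]]_hdim) : R[i] :=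
  (2 ^ k).-root (avg (fun hs : k.-tuple phase_space =>
                        inner 1%:M (weyl_diffs hs T))).

End Weyl.

Arguments phase_space p n : clear implicits.
Arguments hdim p n : clear implicits.

(* Main.v *)
Require Import Defs.
From mathcomp Require Import all_boot all_order all_algebra all_fingroup.
From mathcomp Require Import complex reals trigo lra.

Set Implicit Arguments.
Unset Strict Implicit.
Unset Printing Implicit Defensive.

Import Order.TTheory GRing.Theory Num.Theory.
Local Open Scope ring_scope.
Local Open Scope complex_scope.
Local Open Scope sesquilinear_scope.

(** Everything is compared with one condition, [wflat k U]: all k-fold iterated
    derivatives of U along Weyl operators are the identity.

    The norm.  Each iterated derivative of U is a unitary V, and <1, V> is the
    mean of the diagonal entries of V, all of modulus at most 1.  An average of
    numbers of modulus at most 1 equals 1 only if all of them do, and a unitary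
    with unit diagonal is the identity because its rows have norm 1.  Applied
    to the average over h_1, ..., h_k and then to the trace, this gives
    [Qnorm_eq1].

    The orbit map.  The Weyl operators multiply up to central elements (the
    phases), and A is abelian.  Hence the Leibman derivative of the orbit map
    of U along h is the orbit map of W_h U W_h^* U^* ([leibman_deg_lt_orbit]).
    This uses only that W is a homomorphism modulo the centre, and is proved
    for such a map into an arbitrary group.

    The Clifford hierarchy.  Again for a homomorphism modulo the centre,
    flatness of order at least 2 does not change under left multiplication by
    some w a or by a central element.  So in W_h U W_h^* U^* the first factor
    can be dropped and W_h^* replaced by W_(-h): for k at least 2, flatness of
    order k + 1 of U amounts to flatness of order k of all U W_h U^*
    ([wflat_conjw]).  This is the recursion that defines the hierarchy, except
    for the phases.

    - At order 2, U commutes with every Weyl operator up to a scalar.  The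
      matrix entries then show that U is supported on one translate of the
      diagonal, and is there a multiple of a character of F_p^n; that is, U is
      a multiple of a Weyl operator ([weylT_of_proj_comm], [wflat2_pauli]).
    - From level 2 on, membership does not depend on the phase
      ([clifford_phase]).  In passing from level 1 to level 2 the phase
      matters, but it is automatically right: if c U W_h U^* is a Pauli
      operator, then comparing D-th powers, where D is the order of tau and
      W_a^D = 1, shows that c is a power of tau ([pauli_conj_phase]). *)

(** * Homomorphisms modulo the centre *)

Definition central (H : groupType) (z : H) : Prop := forall x : H, commute z x.

Section ProjectiveHomomorphism.
Variables (A H : groupType) (w : A -> H).
Hypothesis mulAC : forall a b : A, (a * b = b * a)%g.
Hypothesis w_proj :
  forall a b : A, exists2 z, central z & (w (a * b) = z * (w a * w b))%g.
Local Open Scope group_scope.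

(** For w the Weyl operators this is the derivative of x along a. *)
Definition wcomm (a : A) (x : H) : H := w a * x * (w a)^-1 * x^-1.

(** Only the commutators with the elements w a are involved; when w is onto, this
    says that x lies in the k-th term of the upper central series. *)
Fixpoint wflat (k : nat) (x : H) : Prop :=
  match k with
  | 0 => x = 1
  | k'.+1 => forall a, wflat k' (wcomm a x)
  end.

Lemma centralM (y z : H) : central y -> central z -> central (y * z).
Proof. by move=> yC zC x; apply/commute_sym/commuteM; apply/commute_sym. Qed.

Lemma centralV (z : H) : central z -> central z^-1.
Proof. by move=> zC x; apply/commute_sym/commuteV/commute_sym. Qed.

Lemma conj_central (z x t : H) :
  central z -> (z * x) * t * (z * x)^-1 = x * t * x^-1.
Proof.
by move=> zC; rewrite invgM -!mulgA zC !mulgA mulgVK.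
Qed.

Lemma conj_eq1 (x y : H) : y * x * y^-1 = 1 <-> x = 1.
Proof.
split=> [/eqP|->]; last by rewrite mulg1 mulgV.
by rewrite mulg_eq1 invgK => /eqP yx; apply: (mulgI y); rewrite mulg1.
Qed.

Lemma w_comm_central a b : exists2 z, central z & w a * w b = z * (w b * w a).
Proof.
have [y yC yE] := w_proj a b; have [z zC zE] := w_proj b a.
exists (y^-1 * z); first exact: centralM (centralV yC) zC.
by rewrite -mulgA -zE mulAC yE mulKg.
Qed.

(** Since w 1 is itself central, w a^-1 and w a are inverse to each other modulo
    the centre. *)
Lemma wV_central a : exists2 z, central z & (w a)^-1 = z * w a^-1.
Proof.
have w1C : central (w 1).
  have [z zC zE] := w_proj 1 1; rewrite mulg1 in zE.
  suff -> : w 1 = z^-1 by exact: centralV.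
  by apply: (mulgI z); rewrite mulgV; apply: (mulIg (w 1)); rewrite mul1g -mulgA.
have [z zC zE] := w_proj a^-1 a; rewrite mulVg in zE.
exists ((w 1)^-1 * z); first exact: centralM (centralV w1C) zC.
apply: (mulIg (w a)); rewrite mulVg -!mulgA -zE mulVg //.
Qed.

(** Conjugation by w h * w a and by w a * w h agree, because the two products
    differ by a central element. *)
Lemma wcomm_conj a h x :
  wcomm h (w a * x * (w a)^-1) = w a * wcomm h x * (w a)^-1.
Proof.
have [z zC zE] := w_comm_central h a.
rewrite /wcomm !invgM invgK.
have -> : w h * (w a * x * (w a)^-1) * (w h)^-1
          = (w h * w a) * x * (w h * w a)^-1 by rewrite invgM !mulgA.
by rewrite zE conj_central // invgM !mulgA mulgVK.
Qed.

(** Conjugation by w (h * g) is conjugation by w g * w h, so the factor w g comes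
    out of the Leibman derivative: along h, the orbit map of x becomes the orbit
    map of [wcomm h x].  The values of phi are prescribed pointwise so that the
    induction needs no function extensionality. *)
Lemma leibman_deg_lt_orbit k x (phi : A -> H) :
  (forall a, phi a = w a * x * (w a)^-1) -> leibman_deg_lt k phi <-> wflat k x.
Proof.
elim: k x phi => [|k IHk] x phi phiE /=.
  split=> [phi1|x1 a]; last by rewrite phiE; apply/conj_eq1.
  by have := phi1 1; rewrite phiE => /conj_eq1.
have IH h : leibman_deg_lt k (leibman_diff h phi) <-> wflat k (wcomm h x).
  apply: IHk => g; rewrite /leibman_diff !phiE mulAC.
  have [z zC ->] := w_proj g h.
  by rewrite conj_central // /wcomm !invgM !invgK !mulgA mulgVK.
by split=> kP h; apply/IH.
Qed.

Lemma wflat_central k z x : central z -> wflat k.+1 (z * x) <-> wflat k.+1 x.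
Proof.
move=> zC; suff E h : wcomm h (z * x) = wcomm h x.
  by split=> kP h; have := kP h; rewrite E.
by rewrite /wcomm invgM !mulgA -(zC (w h)) -!mulgA zC !mulgA mulgVK.
Qed.

Lemma wflat_conj k a x : wflat k (w a * x * (w a)^-1) <-> wflat k x.
Proof.
elim: k x => [|k IHk] x /=.
  exact: conj_eq1.
by split=> kP h; have := kP h; rewrite wcomm_conj IHk.
Qed.

(** In the commutator of w h with w a * x, exchanging w h and w a costs a central
    factor, and what remains is a conjugate of [wcomm h x].  The central factor
    is harmless only if a further derivative follows, whence the order at least 2. *)
Lemma wflat_mulw k a x : wflat k.+2 (w a * x) <-> wflat k.+2 x.
Proof.
suff E h : wflat k.+1 (wcomm h (w a * x)) <-> wflat k.+1 (wcomm h x).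
  by split=> kP h; apply/E/kP.
have [z zC zE] := w_comm_central h a.
have -> : wcomm h (w a * x) = z * (w a * wcomm h x * (w a)^-1).
  by rewrite /wcomm invgM !mulgA zE !mulgA.
by rewrite wflat_central // wflat_conj.
Qed.

(** Up to the left factor w a and a central factor, [wcomm a x] is the conjugate
    of w a^-1 by x. *)
Lemma wflat_conjw k x : wflat k.+3 x <-> forall a, wflat k.+2 (x * w a * x^-1).
Proof.
have E a : wflat k.+2 (wcomm a x) <-> wflat k.+2 (x * w a^-1 * x^-1).
  have [z zC zE] := wV_central a.
  have -> : wcomm a x = w a * (z * (x * w a^-1 * x^-1)).
    by rewrite /wcomm zE !mulgA -(mulgA (w a) x) -(zC x) !mulgA.
  by rewrite wflat_mulw wflat_central.
by split=> kP a; last exact/E; rewrite -(invgK a); apply/E.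
Qed.

End ProjectiveHomomorphism.

(** * Uniformity norm one *)

(** This is the equality case of the triangle inequality. *)
Lemma avg_eq1 (R : realType) (T : finType) (F : T -> R[i]) :
  (0 < #|T|)%N -> (forall x, `|F x| <= 1) -> avg F = 1 <-> forall x, F x = 1.
Proof.
move=> T_gt0 F_le1; have T_neq0 : #|T|%:R != 0 :> R[i] by rewrite pnatr_eq0 -lt0n.
have sum1 : \sum_(x : T) (1 : R[i]) = #|T|%:R by rewrite sumr_const.
rewrite /avg; split=> [avgF x|F1]; last first.
  by rewrite (eq_bigr _ (fun x _ => F1 x)) sum1 mulVf.
apply: (normC_sum_upper (P := predT) (G := fun=> 1)) => //.
by rewrite sum1 -[LHS](mulVKf T_neq0) avgF mulr1.
Qed.

Lemma unitary_row_norm (C : numClosedFieldType) m (U : unitary_group C m) i :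
  \sum_j `|U i j| ^+ 2 = 1.
Proof.
have /unitarymxP/matrixP/(_ i i) := unitary_valP U.
by rewrite !mxE eqxx mulr1n => <-; apply: eq_bigr => j _; rewrite !mxE normCK.
Qed.

Lemma unitary_diag_le1 (C : numClosedFieldType) m (U : unitary_group C m) i :
  `|U i i| <= 1.
Proof.
rewrite -(expr_le1 (n := 2)) // -(unitary_row_norm U i) (bigD1 i) //= lerDl.
by rewrite sumr_ge0 // => j _; rewrite exprn_ge0.
Qed.

Lemma unitary_diag1 (C : numClosedFieldType) m (U : unitary_group C m) :
  (forall i, U i i = 1) -> U = 1%g.
Proof.
move=> U1; apply: val_inj; apply/matrixP => i j; rewrite /= !mxE.
case: eqVneq => [<-|ij]; first exact: U1.
have := unitary_row_norm U i; rewrite (bigD1 i) //= U1 normr1 expr1n.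
move/eqP; rewrite -subr_eq0 addrAC subrr add0r => /eqP/psumr_eq0P E.
apply/eqP; rewrite -normr_eq0 -sqrf_eq0; apply/eqP/E; last by rewrite eq_sym.
by move=> l _; rewrite exprn_ge0.
Qed.

Section NormOne.
Variables (R : realType) (p n : nat).
Local Notation C := R[i].
Local Notation UG := (unitary_group R[i] (hdim p n)).
Local Notation Wd := (wcomm (@weylU R p n)).

Lemma hdim_gt0 : (0 < hdim p n)%N.
Proof. by apply/card_gt0P; exists 0. Qed.

Lemma inner1_eq1 (V : UG) : inner 1%:M (unitary_val V) = 1 <-> V = 1%g.
Proof.
have trE : inner 1%:M (unitary_val V) = avg (fun i => V i i).
  by rewrite /inner /avg trmx1 map_mx1 mul1mx card_ord.
rewrite trE avg_eq1 ?card_ord ?hdim_gt0 //; last exact: unitary_diag_le1.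
by split=> [/unitary_diag1|-> i] //=; rewrite !mxE eqxx.
Qed.

Lemma inner1_le1 (V : UG) : `|inner 1%:M (unitary_val V)| <= 1.
Proof.
rewrite /inner trmx1 map_mx1 mul1mx normrM normfV normr_nat.
rewrite mulrC ler_pdivrMr ?ltr0n ?hdim_gt0 // mul1r.
apply: le_trans (ler_norm_sum _ _ _) _.
have -> : (hdim p n)%:R = \sum_(i < hdim p n) (1 : C) by rewrite sumr_const card_ord.
by apply: ler_sum => i _; apply: unitary_diag_le1.
Qed.

Lemma weyl_diffs_wcomm hs (V : UG) :
  weyl_diffs hs (unitary_val V) = unitary_val (foldl (fun S h => Wd h S) V hs).
Proof. by elim: hs V => [|h hs IHhs] V //=; rewrite -IHhs. Qed.

Lemma wflat_foldl k (V : UG) :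
  wflat (@weylU R p n) k V <->
  forall hs : k.-tuple (phase_space p n), foldl (fun S h => Wd h S) V hs = 1%g.
Proof.
elim: k V => [|k IHk] V /=.
  by split=> [V1 hs|/(_ [tuple])]; rewrite ?tuple0.
split=> [Vk hs|Vk h]; last by apply/IHk => hs; exact: Vk [tuple of h :: hs].
by case/tupleP: hs => h hs /=; have /IHk := Vk h; apply.
Qed.

Lemma Qnorm_eq1 k (U : UG) :
  Qnorm k (unitary_val U) = 1 <-> wflat (@weylU R p n) k U.
Proof.
rewrite wflat_foldl /Qnorm.
have -> : forall z : C, (2 ^ k).-root z = 1 <-> z = 1.
  move=> z; split=> [/eqP|->]; last by rewrite rootC1 ?expn_gt0.
  by rewrite rootC_eq1 ?expn_gt0 // => /eqP.
rewrite avg_eq1.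
- by split=> E hs; have := E hs; rewrite weyl_diffs_wcomm inner1_eq1.
- by rewrite card_tuple expn_gt0 (_ : (0 < #|_|)%N) //; apply/card_gt0P; exists 0.
- by move=> hs; rewrite weyl_diffs_wcomm inner1_le1.
Qed.

End NormOne.

(** * The roots of unity omega and tau, and the characters of F_p^n *)

Section RootsOfUnity.
Variable R : realType.

Lemma cisD (s t : R) : cis (s + t) = cis s * cis t.
Proof. by rewrite /cis cosD sinD; simpc; rewrite [in LHS](addrC (sin s * _)). Qed.

Lemma cisMn (t : R) m : cis (t *+ m) = cis t ^+ m.
Proof.
elim: m => [|m IHm]; first by rewrite mulr0n expr0 /cis cos0 sin0.
by rewrite mulrS exprS cisD IHm.
Qed.

Variable p : nat.
Hypothesis p_prime : prime p.
Local Notation w := (omega R p).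
Local Notation t := (tau R p).

Let p_neq0 : p%:R != 0 :> R.
Proof. by rewrite pnatr_eq0 -lt0n prime_gt0. Qed.

Lemma cis_pi_p : cis (pi / p%:R : R) ^+ p = -1.
Proof.
rewrite -cisMn -[_ / _ *+ _]mulr_natr divfK // /cis cospi sinpi.
by apply/eqP; rewrite eq_complex /= !eqxx oppr0 eqxx.
Qed.

Lemma omega_cis : w = cis (pi / p%:R) ^+ 2.
Proof. by rewrite -cisMn /omega -[_ / _ *+ _]mulr_natl mulrA. Qed.

Lemma omegaXp : w ^+ p = 1.
Proof. by rewrite omega_cis exprAC cis_pi_p sqrrN expr1n. Qed.

(** With t = pi / p, cos (2 t) = 1 - 2 sin^2 t < 1, as t lies strictly between 0
    and pi. *)
Lemma omega_neq1 : w != 1.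
Proof.
have sin_gt0 : 0 < sin (pi / p%:R : R).
  have p_gt1 : 1 < p%:R :> R by rewrite ltr1n prime_gt1.
  apply: sin_gt0_pi; rewrite divr_gt0 ?pi_gt0 ?ltr0n ?prime_gt0 //=.
  by rewrite ltr_pdivrMr ?ltr0n ?prime_gt0 // ltr_pMr ?pi_gt0.
rewrite omega_cis -cisMn; apply/eqP => /(congr1 (@complex.Re R)) /=.
rewrite cos_mulr2n cos2sin2 => E.
have : sin (pi / p%:R : R) ^+ 2 = 0 by lra.
by apply/eqP; rewrite sqrf_eq0 gt_eqF.
Qed.

Lemma omega_prim : p.-primitive_root w.
Proof.
have [m m_prim] := prim_order_exists (prime_gt0 p_prime) omegaXp.
case/primeP: p_prime => _ dvd_p /dvd_p /orP[] /eqP mE; last by rewrite mE in m_prim.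
by have := prim_expr_order m_prim; rewrite mE expr1 => /eqP;
  rewrite (negPf omega_neq1).
Qed.

Lemma tau_sqr : t ^+ 2 = w.
Proof.
by rewrite /tau exprMn -exprM mulnC exprM sqrrN !expr1n mul1r omega_cis.
Qed.

Lemma tauX_order : t ^+ tau_order p = 1.
Proof.
rewrite /tau_order; case: eqP => [p2|/eqP p_neq2].
  by rewrite exprM tau_sqr omegaXp.
rewrite /tau exprMn cis_pi_p -exprM -signr_odd oddM.
case: (even_prime p_prime) => [p2|->]; first by rewrite p2 in p_neq2.
by rewrite /= expr1 mulrNN mulr1.
Qed.

(** The order of tau divides [tau_order p] and does not divide 2, since
    tau^2 = omega is not 1; both for p odd and for p = 2 (order dividing 4) one
    possibility is left. *)
Lemma tau_prim : (tau_order p).-primitive_root t.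
Proof.
have D_gt0 : (0 < tau_order p)%N.
  by rewrite /tau_order; case: ifP; rewrite ?muln_gt0 (prime_gt0 p_prime).
have [m m_prim m_dvd] := prim_order_exists D_gt0 tauX_order.
have m_ndvd2 : ~~ (m %| 2)%N.
  by rewrite (prim_order_dvd m_prim) tau_sqr omega_neq1.
suff <- : m = tau_order p by [].
move: m_dvd; rewrite /tau_order; case: eqP => [->|_] m_dvd.
  by move: m m_dvd m_ndvd2 {m_prim} => [|[|[|[|[|m]]]]] // /dvdn_leq.
case/primeP: p_prime => _ dvd_p.
by case/dvd_p/orP: m_dvd => /eqP // mE; rewrite mE dvd1n in m_ndvd2.
Qed.

Definition chi (a : 'F_p) : R[i] := w ^+ a.

(** Exponents are representatives, so reduction modulo p must be absorbed by
    omega^p = 1. *)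
Lemma chiD a b : chi (a + b) = chi a * chi b.
Proof.
rewrite /chi -exprD /= [X in (_ %% X)%N](Fp_cast p_prime).
by rewrite (expr_mod _ omegaXp).
Qed.

Lemma chiM a b : chi (a * b) = chi a ^+ b.
Proof.
by rewrite /chi -exprM /= [X in (_ %% X)%N](Fp_cast p_prime) (expr_mod _ omegaXp).
Qed.

Lemma chi0 : chi 0 = 1. Proof. by []. Qed.

Lemma chi_natr m : chi m%:R = w ^+ m.
Proof. by rewrite /chi val_Fp_nat // (expr_mod _ omegaXp). Qed.

Lemma norm_chi a : `|chi a| = 1.
Proof. by rewrite normrX norm_omega expr1n. Qed.

Lemma chi_neq0 a : chi a != 0.
Proof. by rewrite -normr_gt0 norm_chi. Qed.

Lemma chi_inj : injective chi.
Proof.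
move=> a b /eqP; rewrite /chi (eq_prim_root_expr omega_prim) => /eqP E.
have ltp (c : 'F_p) : (c < p)%N
  by rewrite -[X in (_ < X)%N](Fp_cast p_prime) ltn_ord.
by apply: val_inj; rewrite /= -(modn_small (ltp a)) E modn_small.
Qed.

Section Characters.
Variable n : nat.
Implicit Types x y u v : 'rV['F_p]_n.

Lemma dotpDl x y u : dotp (x + y) u = dotp x u + dotp y u.
Proof. by rewrite -big_split; apply: eq_bigr => j _; rewrite !mxE mulrDl. Qed.

Lemma dotpC x y : dotp x y = dotp y x.
Proof. by apply: eq_bigr => j _; rewrite mulrC. Qed.

Lemma dotpDr x u v : dotp x (u + v) = dotp x u + dotp x v.
Proof. by rewrite dotpC dotpDl !(dotpC x). Qed.

Lemma dotp0l u : dotp 0 u = 0.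
Proof. by rewrite /dotp big1 // => j _; rewrite mxE mul0r. Qed.

Lemma dotpNl x u : dotp (- x) u = - dotp x u.
Proof. by apply/eqP; rewrite -addr_eq0 -dotpDl addNr dotp0l. Qed.

Lemma dotp_delta x j : dotp x (delta_mx 0 j) = x 0 j.
Proof.
rewrite /dotp (bigD1 j) //= big1 => [|i ij]; rewrite mxE eqxx /=.
  by rewrite eqxx mulr1 addr0.
by rewrite (negPf ij) mulr0.
Qed.

Lemma chi_dotp_inj x y : (forall u, chi (dotp x u) = chi (dotp y u)) -> x = y.
Proof.
move=> E; apply/rowP => j; apply: chi_inj.
by rewrite -!dotp_delta E.
Qed.

(** The values of mu are p-th roots of unity, because p kills F_p^n; u collects the
    exponents of the values of mu on the standard basis. *)
Lemma characterP (mu : 'rV['F_p]_n -> R[i]) :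
  mu 0 = 1 -> {morph mu : x y / x + y >-> x * y} ->
  exists u, forall x, mu x = chi (dotp x u).
Proof.
move=> mu0 muD.
have muMn x m : mu (x *+ m) = mu x ^+ m.
  by elim: m => [|m IHm]; rewrite ?mulr0n // mulrS exprS muD IHm.
have muXp x : mu x ^+ p = 1.
  rewrite -muMn (_ : x *+ p = 0) //; apply/rowP => j; rewrite mulmxnE mxE.
  by rewrite -mulr_natr pchar_Fp_0 // mulr0.
pose i_ j := sval (prim_rootP omega_prim (muXp (delta_mx 0 j))).
have i_E j : mu (delta_mx 0 j) = w ^+ i_ j by rewrite /i_; case: prim_rootP.
exists (\row_j (i_ j)%:R) => x.
have {1}-> : x = \sum_j delta_mx 0 j *+ (x 0 j : nat).
  rewrite {1}[x]row_sum_delta; apply: eq_bigr => j _.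
  by rewrite -scaler_nat natr_Zp.
rewrite (big_morph mu muD mu0) (big_morph chi chiD chi0).
by apply: eq_bigr => j _; rewrite muMn i_E mxE mulrC chiM chi_natr.
Qed.

End Characters.
End RootsOfUnity.

(** * The Weyl operators and the matrices that normalise them up to scalars *)

Section WeylAlgebra.
Variables (R : realType) (p n : nat).
Hypothesis p_prime : prime p.
Local Notation C := R[i].
Local Notation d := (hdim p n).
Local Notation UG := (unitary_group R[i] d).
Local Notation chi := (@chi R p).
Local Notation vec := 'rV['F_p]_n.
Local Notation rk x := (enum_rank (x : basis p n)).
Implicit Types (a b : phase_space p n) (M : 'M[C]_d) (U V : UG).
Implicit Types (x y u v : vec).

(** Without the normalising power of tau, only powers of omega occur in products. *)
Definition weylT a : 'M[C]_d := weylZ R a.1 *m weylX R a.2.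

Definition weyl_phase a : C :=
  tau R p ^- (\sum_(j < n) nat_of_ord (a.1 0 j * a.2 0 j : 'F_p)%R).

Lemma weylE a : weyl R a = weyl_phase a *: weylT a.
Proof. by []. Qed.

Lemma norm_weyl_phase a : `|weyl_phase a| = 1.
Proof. by rewrite normfV normrX norm_tau expr1n invr1. Qed.

Lemma phase_neq0 (c : C) : `|c| = 1 -> c != 0.
Proof. by move=> c1; rewrite -normr_gt0 c1. Qed.

Lemma weylT_mulE a M i j :
  (weylT a *m M) i j =
  chi (dotp (enum_val i) a.1) * M (rk (enum_val i - a.2)) j.
Proof.
rewrite /weylT -mulmxA mul_diag_mx !mxE (bigD1 (rk (enum_val i - a.2))) //= big1.
  by rewrite !mxE enum_rankK subrK eqxx mul1r addr0.
move=> k kP; rewrite !mxE; case: eqP => [E|_]; last by rewrite mul0r.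
by case/eqP: kP; apply: enum_val_inj; rewrite enum_rankK E addrK.
Qed.

Lemma mul_weylTE a M i j :
  (M *m weylT a) i j =
  M i (rk (enum_val j + a.2)) * chi (dotp (enum_val j + a.2) a.1).
Proof.
rewrite !mxE (bigD1 (rk (enum_val j + a.2))) //= big1 => [|k kP].
  by rewrite /weylT mul_diag_mx !mxE enum_rankK eqxx mulr1 addr0.
rewrite /weylT mul_diag_mx !mxE; case: eqP => [E|_]; last by rewrite !mulr0.
by case/eqP: kP; apply: enum_val_inj; rewrite enum_rankK E.
Qed.

Lemma weylT_entry a i j :
  weylT a i j = chi (dotp (enum_val i) a.1) *+ (enum_val i == enum_val j + a.2).
Proof. by rewrite /weylT mul_diag_mx !mxE mulr_natr. Qed.

Lemma weylT0 : weylT 0 = 1%:M.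
Proof.
apply/matrixP => i j; rewrite weylT_entry dotpC dotp0l addr0 !mxE.
by rewrite (inj_eq enum_val_inj).
Qed.

Lemma weylTD a b : weylT a *m weylT b = chi (- dotp a.2 b.1) *: weylT (a + b).
Proof.
apply/matrixP => i j; rewrite weylT_mulE [in RHS]mxE !weylT_entry enum_rankK /=.
rewrite subr_eq -addrA (addrC b.2) !mulrnAr -!(chiD _ p_prime); congr (chi _ *+ _).
by rewrite dotpDl dotpDr dotpNl addrA addrC.
Qed.

Lemma scalar_central U (c : C) : unitary_val U = c%:M -> central U.
Proof. by move=> Uc V; apply: val_inj; rewrite /= Uc scalar_mxC. Qed.

(** A quotient of two proportional unitaries is a scalar matrix. *)
Lemma phase_central U V (c : C) :
  unitary_val U = c *: unitary_val V -> exists2 z, central z & U = (z * V)%g.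
Proof.
move=> UV; exists (U * V^-1)%g; last by rewrite mulgVK.
apply: (@scalar_central _ c); rewrite /= UV -scalemxAl.
by have /unitarymxP -> := unitary_valP V; rewrite scalemx1.
Qed.

Lemma weyl_proj a b :
  exists2 z, central z & weylU R (a * b)%g = (z * (weylU R a * weylU R b))%g.
Proof.
pose c := weyl_phase a * (weyl_phase b * chi (- dotp a.2 b.1)).
have c1 : `|c| = 1 by rewrite !normrM !norm_weyl_phase norm_chi !mulr1.
have c_neq0 := phase_neq0 c1.
apply: (@phase_central _ _ (weyl_phase (a + b) * c^-1)).
rewrite /= !weylE -scalemxAl -scalemxAr weylTD !scalerA.
by rewrite -!mulrA mulVf // mulr1.
Qed.

Lemma phase_space_mulC a b : (a * b = b * a)%g.
Proof. exact: addrC. Qed.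

(** For each pair among the m factors, one X^v has to be moved past one Z^u. *)
Lemma weylT_expn a m U :
  unitary_val U = weylT a ->
  unitary_val (U ^+ m)%g
  = chi (- (dotp a.2 a.1 *+ 'C(m, 2))) *: weylT (a.1 *+ m, a.2 *+ m).
Proof.
move=> UE; elim: m => [|m IHm].
  by rewrite !mulr0n oppr0 scale1r; exact/esym/weylT0.
rewrite expgS /= IHm UE -scalemxAr weylTD scalerA -(chiD _ p_prime).
congr (chi _ *: weylT _); last by rewrite !mulrS.
rewrite /= binS bin1 mulrnDr opprD; congr (_ - _).
by elim: m {IHm} => [|m IHm]; rewrite ?mulr0n ?mulrS ?dotpDr ?IHm // dotpC dotp0l.
Qed.

Lemma scaled_expn U V (c : C) m :
  unitary_val V = c *: unitary_val U ->
  unitary_val (V ^+ m)%g = c ^+ m *: unitary_val (U ^+ m)%g.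
Proof.
move=> VU; elim: m => [|m IHm]; first by rewrite expr0 scale1r.
by rewrite !expgS /= IHm VU -scalemxAl -scalemxAr scalerA exprS.
Qed.

Lemma mulrn_tau_order (M : lmodType 'F_p) (x : M) : x *+ tau_order p = 0.
Proof.
have xp : x *+ p = 0 by rewrite -scaler_nat pchar_Fp_0 // scale0r.
by rewrite /tau_order; case: ifP => // _; rewrite mulnC mulrnA xp mul0rn.
Qed.

Lemma bin2_tau_order : (p %| 'C(tau_order p, 2))%N.
Proof.
rewrite /tau_order; case: eqP => [->|/eqP p_neq2] //.
by rewrite prime_dvd_bin //= ltn_neqAle eq_sym p_neq2 prime_gt1.
Qed.

(** Raised to the D-th power, D = [tau_order p], the phases contribute tau^D = 1 and
    omega to the power of a multiple of 'C(D, 2), which p divides; for p = 2 this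
    needs D = 4 rather than 2. *)
Lemma weylU_order a : (weylU R a ^+ tau_order p)%g = 1%g.
Proof.
pose T := UnitaryGroup (mul_unitarymx (weylZ_unitary R a.1) (weylX_unitary R a.2)).
have WT : unitary_val (weylU R a) = weyl_phase a *: unitary_val T by [].
apply: val_inj; rewrite /= (scaled_expn _ WT) (@weylT_expn a) // !mulrn_tau_order.
have /dvdnP [m ->] := bin2_tau_order.
rewrite mulnC mulrnA -[_ *+ p]mulr_natr pchar_Fp_0 // mulr0 mul0rn oppr0 scale1r.
rewrite exprVn -exprM mulnC exprM tauX_order // expr1n invr1 scale1r.
exact: weylT0.
Qed.

(** Entry by entry, the hypothesis for (u, v) says that moving both indices by v
    multiplies the entry at (y, x) by a constant times chi ((y - x).u).  For
    v = 0, two nonzero entries give the same character of u, so y - x is the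
    same for all nonzero entries: M lives on one translate of the diagonal.  For
    u = 0, translations multiply the entries f x on this translate by constants,
    so f is a multiple of a character of F_p^n. *)
Lemma weylT_of_proj_comm M :
  (forall a, exists c, weylT a *m M = c *: (M *m weylT a)) ->
  exists f a, M = f *: weylT a.
Proof.
move=> Mcomm; pose g y x := M (rk y) (rk x).
have gE u v : exists c, forall y x,
    chi (dotp (y - x) u) * g y x = c * g (y + v) (x + v).
  have [c /matrixP cE] := Mcomm (u, v); exists c => y x.
  have := cE (rk (y + v)) (rk x).
  rewrite weylT_mulE [in RHS]mxE mul_weylTE !enum_rankK /= addrK -!/(g _ _) => E.
  have xD : chi (dotp (y - x) u) = chi (dotp (y + v) u) / chi (dotp (x + v) u).
    apply: (mulIf (chi_neq0 R (dotp (x + v) u))).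
    rewrite divfK ?chi_neq0 // -chiD // -dotpDl; congr (chi (dotp _ _)).
    by rewrite addrA subrK.
  rewrite xD mulrAC E mulrA mulfK ?chi_neq0 //.
have MgE i j : M i j = g (enum_val i) (enum_val j) by rewrite /g !enum_valK.
have [/forallP M0|] := boolP [forall y, forall x, g y x == 0].
  exists 0, 0; rewrite scale0r; apply/matrixP => i j.
  by rewrite MgE mxE; have /forallP/(_ (enum_val j))/eqP := M0 (enum_val i).
rewrite negb_forall => /existsP[y0]; rewrite negb_forall => /existsP[x0 g0].
(* f lists the entries on the translate of the diagonal through (y0, x0). *)
pose v := y0 - x0; pose f x := g (x + v) x.
have gf y x : g y x = f x *+ (y == x + v).
  rewrite /f; case: (y =P x + v) => [->|yxv] //; rewrite mulr0n.
  apply/eqP/contraT => gyx; case: yxv; apply/eqP; rewrite addrC -subr_eq; apply/eqP.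
  apply: (chi_dotp_inj (R := R)) => // u.
  have [c cE] := gE u 0.
  have := cE y x; rewrite !addr0 => /(mulIf gyx) ->.
  by have := cE y0 x0; rewrite !addr0 => /(mulIf g0) ->.
have fD z : exists2 c, c != 0 & forall x, f x = c * f (x + z).
  have [c cE] := gE 0 z; have cE' x : f x = c * f (x + z).
    have := cE (x + v) x; rewrite dotpC dotp0l chi0 mul1r /f => ->.
    by rewrite addrAC.
  exists c => //; apply: contraNneq g0 => c0.
  by rewrite gf cE' c0 mul0r mul0rn.
have f0 : f 0 != 0.
  apply: contraNneq g0 => f0; rewrite gf; have [c _ cE] := fD (- x0).
  by rewrite cE subrr f0 mulr0 mul0rn.
have fM x y : f (x + y) = f x / f 0 * f y.
  have [c c0 cE] := fD y.
  have fy z : f (z + y) = c^-1 * f z by rewrite (cE z) mulKf.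
  by rewrite -{2}[y]add0r !fy mulrCA mulfVK // mulrC.
have [u uE] : exists u, forall x, f x / f 0 = chi (dotp x u).
  apply: (characterP (R := R)) => //= [|x y]; first by rewrite mulfV.
  by rewrite fM mulrA.
(* The character in the entries of weylT is evaluated at the row index x + v,
   whereas u was found from the column index x. *)
exists (f 0 * chi (- dotp v u)), (u, v); apply/matrixP => i j.
rewrite MgE gf mxE weylT_entry /= mulrnAr -[f _](mulfVK f0) uE.
case: eqP => [->|] //; rewrite !mulr1n mulrC -mulrA -chiD //.
by rewrite dotpDl addrCA addNr addr0.
Qed.

End WeylAlgebra.

(** * Flatness and the Clifford hierarchy *)

Section Clifford.
Variables (R : realType) (p n : nat).
Hypothesis p_prime : prime p.
Local Notation C := R[i].
Local Notation d := (hdim p n).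
Local Notation UG := (unitary_group R[i] d).
Local Notation chi := (@chi R p).
Local Notation vec := 'rV['F_p]_n.
Local Notation rk x := (enum_rank (x : basis p n)).
Implicit Types (a b : phase_space p n) (M : 'M[C]_d) (U V : UG).
Implicit Types (x y u v : vec).

Lemma unitary_scale_norm U V (c : C) :
  unitary_val U = c *: unitary_val V -> `|c| = 1.
Proof.
move=> UV; pose i := Ordinal (hdim_gt0 p n).
apply/eqP; rewrite -sqrp_eq1 //; apply/eqP.
rewrite -(unitary_row_norm U i) -[LHS]mulr1 -(unitary_row_norm V i) mulr_sumr.
by apply: eq_bigr => j _; rewrite UV mxE normrM exprMn.
Qed.

Lemma weylT_scale_inj a (c e : C) : c *: weylT R a = e *: weylT R a -> c = e.
Proof.
pose x : vec := 0.
move/matrixP/(_ (rk (x + a.2)) (rk x)).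
rewrite [in LHS]mxE [in RHS]mxE !weylT_entry !enum_rankK eqxx.
by move/(mulIf (chi_neq0 _ _)).
Qed.

(** By the classification M is a multiple of some weylT a; if it is nonzero, then
    a is symplectically orthogonal to everything, so a = 0. *)
Lemma scalar_of_weyl_comm M :
  (forall a, weylT R a *m M = M *m weylT R a) -> exists f, M = f%:M.
Proof.
move=> Mcomm; have [a|f [a ME]] := weylT_of_proj_comm p_prime (M := M).
  by exists 1; rewrite scale1r.
have [f0|f_neq0] := eqVneq f 0; first by exists 0; rewrite ME f0 scale0r raddf0.
suff a0 : a = 0 by exists f; rewrite ME a0 weylT0 scalemx1.
have chiE b : chi (dotp a.2 b.1) = chi (dotp b.2 a.1).
  have := Mcomm b; rewrite ME -scalemxAr -scalemxAl !weylTD //.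
  rewrite (addrC b) => /(scalerI f_neq0)/weylT_scale_inj E.
  apply: (mulIf (chi_neq0 R (- dotp a.2 b.1))).
  by rewrite -[in RHS]E -!chiD // !subrr.
have a1 : a.1 = 0.
  apply: (chi_dotp_inj (R := R)) => // v.
  by rewrite dotpC -(chiE (0, v)) dotpC !dotp0l.
have a2 : a.2 = 0.
  apply: (chi_dotp_inj (R := R)) => // u.
  by rewrite (chiE (u, 0)) !dotp0l.
by case: a a1 a2 {ME chiE} => a1 a2 /= -> ->.
Qed.

Lemma weylU_comm a V : (weylU R a * V = V * weylU R a)%g ->
  weylT R a *m unitary_val V = unitary_val V *m weylT R a.
Proof.
move/(congr1 (@unitary_val _ _)); rewrite /= weylE -scalemxAl -scalemxAr.
by apply: scalerI; rewrite phase_neq0 ?norm_weyl_phase.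
Qed.

Lemma tau_order_gt0 : (0 < tau_order p)%N.
Proof. by rewrite (prim_order_gt0 (tau_prim R p_prime)). Qed.

Lemma pauli_weyl a : pauli (weyl R a).
Proof. by exists (Ordinal tau_order_gt0), a; rewrite scale1r. Qed.

(** For V flat of order 2, every [wcomm h V] commutes with all Weyl operators and
    is thus a scalar, so that V commutes with them up to scalars.  Conversely the
    commutators of Weyl operators are central. *)
Lemma wflat2_pauli V :
  wflat (@weylU R p n) 2 V <-> exists2 c : C, `|c| = 1 & pauli (c *: unitary_val V).
Proof.
have proj := weyl_proj R (n := n) p_prime; have mulC := @phase_space_mulC p n.
split=> [V2|[c c1 [t [a cV]]]]; last first.
  have [|z zC ->] := @phase_central _ _ _ V (weylU R a) (c^-1 * tau R p ^+ t).
    by rewrite -scalerA -cV scalerA mulVf ?scale1r ?phase_neq0.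
  rewrite wflat_central // -[weylU R a]mulg1 wflat_mulw // => h h'.
  by rewrite /wcomm !(mulg1, mulgV, invg1).
have [h|f [a VE]] := weylT_of_proj_comm p_prime (M := unitary_val V).
  have [b|f fE] := scalar_of_weyl_comm (M := unitary_val (wcomm (@weylU R p n) h V)).
    apply: weylU_comm; have := V2 h b; rewrite {1}/wcomm => /eqP.
    by rewrite mulg_eq1 invgK => /eqP {2}<-; rewrite mulgVK.
  exists f.
  have /(congr1 (@unitary_val _ _)) :
      (weylU R h * V = wcomm (@weylU R p n) h V * (V * weylU R h))%g.
    by rewrite /wcomm !mulgA mulgVK mulgVK.
  rewrite /= in fE *; rewrite fE mul_scalar_mx weylE -scalemxAl -!scalemxAr.
  by rewrite scalerA mulrC -scalerA; apply: scalerI;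
     rewrite phase_neq0 ?norm_weyl_phase.
have VW : unitary_val V = (f / weyl_phase R a) *: unitary_val (weylU R a).
  by rewrite [in RHS]/= weylE scalerA divfK ?phase_neq0 ?norm_weyl_phase.
have c1 := unitary_scale_norm VW.
exists (f / weyl_phase R a)^-1; first by rewrite normfV c1 invr1.
by rewrite VW scalerA mulVf ?phase_neq0 // scale1r; apply: pauli_weyl.
Qed.

(** If c Y = tau^s W_a, the D-th powers of Y and W_a being 1 forces c^-1 tau^s to be
    a D-th root of unity, hence a power of tau. *)
Lemma pauli_conj_phase (Y : UG) (c : C) (t : nat) :
  (Y ^+ tau_order p)%g = 1%g -> pauli (c *: unitary_val Y) -> `|c| = 1 ->
  pauli (tau R p ^+ t *: unitary_val Y).
Proof.
move=> Y1 [s [a cY]] c1; pose e := c^-1 * tau R p ^+ s.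
have YE : unitary_val Y = e *: unitary_val (weylU R a).
  by rewrite -scalerA -cY scalerA mulVf ?scale1r ?phase_neq0.
have e1 : e ^+ tau_order p = 1.
  have := scaled_expn (tau_order p) YE; rewrite Y1 weylU_order //=.
  pose o := Ordinal (hdim_gt0 p n).
  by rewrite scalemx1 => /matrixP/(_ o o); rewrite !mxE eqxx.
have [i eE] := prim_rootP (tau_prim R p_prime) e1.
exists (Ordinal (ltn_pmod (t + i) tau_order_gt0)), a.
by rewrite YE eE scalerA -exprD (expr_mod _ (tauX_order R p_prime)).
Qed.

Lemma clifford_phase k M (c : C) :
  `|c| = 1 -> clifford k.+2 M -> clifford k.+2 (c *: M).
Proof.
move=> c1; have cc : c * c^* = 1 by rewrite -normCK c1 expr1n.
have cE P : (c *: M) *m P *m (c *: M)^t* = M *m P *m M^t*.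
  rewrite linearZ /= map_mxZ -!scalemxAl -scalemxAr scalerA cc scale1r //.
case=> /unitarymxP M1 MP; split=> [|P /MP]; last by rewrite cE.
by apply/unitarymxP; rewrite -M1 -[X in X *m _]mulmx1 cE mulmx1.
Qed.

(** At level 1 the phase is controlled by the order of V W_a V^*, at higher levels
    it is immaterial. *)
Lemma clifford_conj_phase k V a (c : C) t :
  `|c| = 1 -> clifford k.+1 (c *: unitary_val (V * weylU R a * V^-1)%g) ->
  clifford k.+1 (tau R p ^+ t *: unitary_val (V * weylU R a * V^-1)%g).
Proof.
case: k => [|k] c1 cP.
  apply: pauli_conj_phase cP c1.
  have -> m : ((V * weylU R a * V^-1) ^+ m = V * weylU R a ^+ m * V^-1)%g.
    elim: m => [|m IHm]; first by rewrite !expg0 mulg1 mulgV.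
    by rewrite !expgS IHm !mulgA mulgVK.
  by rewrite (weylU_order R p_prime) mulg1 mulgV.
have -> : tau R p ^+ t = tau R p ^+ t * c^-1 * c.
  by rewrite mulfVK ?phase_neq0.
rewrite -scalerA; apply: clifford_phase cP.
by rewrite normrM normfV c1 invr1 normrX norm_tau expr1n mulr1.
Qed.

(** The derivative recursion [wflat_conjw] and the recursion of the hierarchy both
    test V W_a V^*, the first up to a phase and the second for all tau^t W_a. *)
Lemma clifford_succ k V :
  (forall V', wflat (@weylU R p n) k.+2 V' <->
     exists2 c : C, `|c| = 1 & clifford k.+1 (c *: unitary_val V')) ->
  wflat (@weylU R p n) k.+3 V <-> clifford k.+2 (unitary_val V).
Proof.
move=> IH; rewrite (wflat_conjw (@phase_space_mulC p n) (weyl_proj R p_prime)).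
split=> [VP|[_ VP] a].
  split=> [|_ [t [a ->]]]; first exact: unitary_valP.
  have -> : V *m (tau R p ^+ t *: weyl R a) *m (unitary_val V)^t*
            = tau R p ^+ t *: unitary_val (V * weylU R a * V^-1)%g.
    by rewrite -scalemxAr -scalemxAl.
  by have /IH[c c1 /(clifford_conj_phase t c1)] := VP a.
apply/IH; exists 1; first exact: normr1.
by rewrite scale1r; apply: VP; apply: pauli_weyl.
Qed.

Lemma wflat_clifford_phase k V :
  wflat (@weylU R p n) k.+2 V <->
  exists2 c : C, `|c| = 1 & clifford k.+1 (c *: unitary_val V).
Proof.
elim: k V => [|k IHk] V; first exact: wflat2_pauli.
rewrite clifford_succ //; split=> [VP|[c c1 cP]].
  by exists 1; [exact: normr1 | rewrite scale1r].
rewrite -[unitary_val V]scale1r -(mulVf (phase_neq0 c1)) -scalerA.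
by apply: clifford_phase cP; rewrite normfV c1 invr1.
Qed.

Lemma wflat_clifford k V :
  wflat (@weylU R p n) k.+3 V <-> clifford k.+2 (unitary_val V).
Proof. exact/clifford_succ/wflat_clifford_phase. Qed.

End Clifford.

(* Level 1 of the hierarchy contains only the phases tau ^+ t, whereas the
   other two conditions do not see the phase of U: for k = 2 the equivalence
   with level k - 1 = 1 holds exactly up to a global phase c.  The levels at
   least 2 are invariant under global phases. *)
Theorem proposition2p4 (R : realType) (p n k : nat)
    (U : unitary_group R[i] (hdim p n))
    (p_prime : prime p) (n_gt0 : (0 < n)%N) (k_gt0 : (0 < k)%N) :
  [/\ Qnorm k U = 1 <-> leibman_deg_lt k (weyl_orbit U),
      (2 <= k)%N ->
        (Qnorm k U = 1 <->
         exists2 c : R[i], `|c| = 1 & clifford k.-1 (c *: unitary_val U))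
    & (3 <= k)%N -> (Qnorm k U = 1 <-> clifford k.-1 U)].
Proof.
have QE := Qnorm_eq1 k U; split.
- apply: (iff_trans QE); apply: iff_sym.
  exact: leibman_deg_lt_orbit (@phase_space_mulC p n) (weyl_proj R p_prime) _ _ _ _.
- case: k k_gt0 QE => [|[|k]] // _ QE _; apply: (iff_trans QE).
  exact: wflat_clifford_phase.
- case: k k_gt0 QE => [|[|[|k]]] // _ QE _; apply: (iff_trans QE).
  exact: wflat_clifford.
Qed.
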